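(* Let $NB$ be the variety of normal bands, i.e. the variety of all bands satisfying the identity $zxyz\approx zyxz$. Then $\dim(NB)=4$.
   Context: A band is an idempotent semigroup, viewed as an algebra of type $(2)$ (one binary operation, written as juxtaposition). A hypersubstitution of type $(2)$ is a choice $\sigma$ of a binary term $\sigma(xy)$ in the variables $x,y$. For an algebra $\mathbf{A}=(A,\cdot)$ of type $(2)$ the derived algebra $\mathbf{A}_{\sigma}$ is the set $A$ with the binary term operation induced by $\sigma(xy)$ on $\mathbf{A}$. For a variety $V$ of type $(2)$, the derived variety $V_{\sigma}$ is the variety (of type $(2)$) generated by $\{\mathbf{A}_{\sigma}:\mathbf{A}\in V\}$; it is proper if $V_{\sigma}\neq V$. The dimension $\dim(V)$ is the cardinality of the set of all proper derived varieties $V_{\sigma}$ of $V$ that are included in $V$, where $\sigma$ ranges over all hypersubstitutions of type $(2)$. *)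

(* Defs.v *)
From mathcomp Require Import all_boot.
From mathcomp Require Import boolp classical_sets functions cardinality.
Set Implicit Arguments.
Unset Strict Implicit.
Unset Printing Implicit Defensive.
Local Open Scope classical_set_scope.

(* MathComp's magmaType lives in a universe too large for classes of magmas   *)
(* to be values of type set, hence this record.                               *)
Record algebra : Type := Algebra {
  carrier :> Type;
  op : carrier -> carrier -> carrier;
  carrier_nonempty : inhabited carrier
}.

Declare Scope algebra_scope.
Notation "x * y" := (op x y) : algebra_scope.
Local Open Scope algebra_scope.

Definition homomorphism (A B : algebra) (f : A -> B) : Prop :=
  {morph f : x y / x * y}.

Lemma product_nonempty (I : Type) (A : I -> algebra) :
  inhabited (forall i, A i).
Proof.
constructor=> i; apply: unsquash.
by case: (carrier_nonempty (A i)) => x; exact: squash x.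
Qed.

Definition product_algebra (I : Type) (A : I -> algebra) : algebra :=
  Algebra (fun x y i => x i * y i) (product_nonempty A).

(* Subalgebras are taken up to isomorphism, as domains of injective           *)
(* homomorphisms.                                                             *)
Record variety (V : set algebra) : Prop := Variety {
  variety_image : forall (A B : algebra) (f : A -> B),
    homomorphism f -> (forall b, exists a, f a = b) -> V A -> V B;
  variety_sub : forall (A B : algebra) (f : B -> A),
    homomorphism f -> injective f -> V A -> V B;
  variety_product : forall (I : Type) (A : I -> algebra),
    (forall i, V (A i)) -> V (product_algebra A)
}.

Definition generated_variety (K : set algebra) : set algebra :=
  smallest variety K.

Inductive binary_term : Type :=
  | VarX
  | VarY
  | Mul of binary_term & binary_term.

Fixpoint term_op (A : algebra) (t : binary_term) (x y : A) : A :=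
  match t with
  | VarX => x
  | VarY => y
  | Mul t1 t2 => term_op t1 x y * term_op t2 x y
  end.

(* A hypersubstitution sigma is identified with the term sigma(xy). *)
Definition hypersubstitution : Type := binary_term.

Definition derived_algebra (s : hypersubstitution) (A : algebra) : algebra :=
  Algebra (@term_op A s) (carrier_nonempty A).

Definition derived_variety (V : set algebra) (s : hypersubstitution) :
    set algebra :=
  generated_variety [set derived_algebra s A | A in V].

(* Derived varieties given by different hypersubstitutions but equal as       *)
(* classes are counted once.                                                  *)
Definition proper_derived_subvarieties (V : set algebra) :
    set (set algebra) :=
  [set W | exists s : hypersubstitution,
    [/\ W = derived_variety V s, W <> V & W `<=` V]].

Definition has_dimension (V : set algebra) (n : nat) : Prop :=
  (proper_derived_subvarieties V #= `I_n)%card.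

Definition band (A : algebra) : Prop :=
  associative (@op A) /\ idempotent_op (@op A).

Definition normal_bands : set algebra :=
  [set A | band A /\ forall x y z : A, z * x * y * z = z * y * x * z].

(* Main.v *)
(* A binary term in two variables takes, on every band, the value of one of   *)
(* the six elements [x], [y], [xy], [yx], [xyx], [yxy] of the free band of    *)
(* rank two. On normal bands [xy] and [yx] give all of [NB], while the other  *)
(* four give the left zero, right zero, left normal and right normal bands.   *)
(* Which of the two-element left zero band, right zero band and semilattice   *)
(* they contain tells these five varieties apart.                             *)

From Stdlib Require List.
From mathcomp Require Import all_boot.
From mathcomp Require Import boolp classical_sets functions cardinality.
Require Import Defs.
Set Implicit Arguments.
Unset Strict Implicit.
Unset Printing Implicit Defensive.
Local Open Scope classical_set_scope.
Local Open Scope algebra_scope.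

(** The derived variety depends only on the operation that the term induces on bands
    ([derived_variety_equiv]), so six words suffice ([band_term_normal_form]). Each is settled by
    [derived_variety_eq]: a variety is the derived one as soon as it contains all derived algebras
    and each of its members is one of them, so no closure is ever computed. The words [XY] and [YX]
    return all normal bands, a class closed under reversal. For the other four words, each member of
    the target variety is a normal band and is its own derived algebra, so the target lies inside
    the normal bands. The substantial case is [XYX], with its mirror image [YXY]: it rests on the
    commutation of inner factors ([normal_bandC]). Distinct values of [signature] then leave exactly
    four proper derived varieties. *)

(** * Equational classes are varieties *)

Inductive term : Type := Var of nat | App of term & term.

Fixpoint eval (A : algebra) (v : nat -> A) (t : term) : A :=
  match t with
  | Var i => v i
  | App t1 t2 => eval v t1 * eval v t2
  end.

Definition models (l r : term) : set algebra :=
  [set A : algebra | forall v : nat -> A, eval v l = eval v r].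

Lemma eval_morph (A B : algebra) (f : A -> B) (v : nat -> A) (t : term) :
  homomorphism f -> f (eval v t) = eval (f \o v) t.
Proof. by move=> fM; elim: t => //= t1 <- t2 <-; rewrite fM. Qed.

(** The easy half of Birkhoff's theorem: assignments lift along surjections, and identities are
    tested after an injection or coordinatewise. *)
Lemma variety_models (l r : term) : variety (models l r).
Proof.
split=> [A B f fM f_surj Alr v|A B f fM f_inj Alr v|I A Alr v].
- have [g gK] := choice (fun i => f_surj (v i)).
  have -> : v = f \o g by apply: funext => i /=; rewrite gK.
  by rewrite -!eval_morph // Alr.
- by apply: f_inj; rewrite !eval_morph.
- apply: functional_extensionality_dep => i.
  have pM : @homomorphism (product_algebra A) (A i) (fun x => x i) by [].
  by rewrite !(eval_morph v _ pM) Alr.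
Qed.

Lemma varietyI (V W : set algebra) :
  variety V -> variety W -> variety (V `&` W).
Proof.
move=> [Vi Vs Vp] [Wi Ws Wp]; split.
- by move=> A B f fM fs [VA WA]; split; [exact: (Vi A B f)|exact: (Wi A B f)].
- by move=> A B f fM fi [VA WA]; split; [exact: (Vs A B f)|exact: (Ws A B f)].
- by move=> I A VWA; split; [apply: Vp|apply: Wp] => i; have [] := VWA i.
Qed.

(** Bridges identities stated with three quantified elements and [models], whose assignments are
    infinite. The default value of [nth] is the third element, so it is read off at index 2; the
    second hypothesis says that [l] and [r] involve no further variables. *)
Lemma variety_identity3 (K : set algebra) (l r : term) :
  (forall A : algebra, K A <-> forall x y z : A,
     eval (nth z [:: x; y]) l = eval (nth z [:: x; y]) r) ->
  (forall (A : algebra) (v : nat -> A) (t : term), t = l \/ t = r ->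
     eval v t = eval (nth (v 2) [:: v 0; v 1]) t) ->
  variety K.
Proof.
move=> KE supp; suff -> : K = models l r by exact: variety_models.
apply/seteqP; split=> A /=.
- by move/KE => Alr v; rewrite (supp _ v l) ?(supp _ v r); auto.
- by move=> Alr; apply/KE => x y z; exact: Alr.
Qed.

Definition left_zero_bands : set algebra :=
  [set A : algebra | forall x y : A, x * y = x].
Definition right_zero_bands : set algebra :=
  [set A : algebra | forall x y : A, x * y = y].
Definition left_normal_bands : set algebra :=
  [set A : algebra | band A /\ forall x y z : A, x * y * z = x * z * y].
Definition right_normal_bands : set algebra :=
  [set A : algebra | band A /\ forall x y z : A, x * y * z = y * x * z].

Definition x0 : term := Var 0.
Definition x1 : term := Var 1.
Definition x2 : term := Var 2.

Ltac identity l r :=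
  apply: (@variety_identity3 _ l r) => [A|A v t [->|->] //].

Lemma variety_band : variety band.
Proof.
have -> : band = [set A : algebra | associative (@op A)] `&`
    [set A : algebra | idempotent_op (@op A)] by [].
apply: varietyI.
- by identity (App x0 (App x1 x2)) (App (App x0 x1) x2).
- by identity (App x0 x0) x0; split=> /= h x; last exact: (h x x x).
Qed.

Lemma variety_left_zero_bands : variety left_zero_bands.
Proof.
by identity (App x0 x1) x0; split=> /= h x y; last exact: (h x y x).
Qed.

Lemma variety_right_zero_bands : variety right_zero_bands.
Proof.
by identity (App x0 x1) x1; split=> /= h x y; last exact: (h x y x).
Qed.

Lemma variety_left_normal_bands : variety left_normal_bands.
Proof.
apply: (varietyI variety_band).
by identity (App (App x0 x1) x2) (App (App x0 x2) x1).
Qed.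

Lemma variety_right_normal_bands : variety right_normal_bands.
Proof.
apply: (varietyI variety_band).
by identity (App (App x0 x1) x2) (App (App x1 x0) x2).
Qed.

Lemma variety_normal_bands : variety normal_bands.
Proof.
apply: (varietyI variety_band).
by identity (App (App (App x2 x0) x1) x2) (App (App (App x2 x1) x0) x2).
Qed.

(** * Binary terms over bands *)

Definition XY : binary_term := Mul VarX VarY.
Definition YX : binary_term := Mul VarY VarX.
Definition XYX : binary_term := Mul XY VarX.
Definition YXY : binary_term := Mul YX VarY.

Definition band_equiv (s t : binary_term) : Prop :=
  forall A : algebra, band A -> @term_op A s =2 @term_op A t.

(** Deletion of a repeated [x] or [xy] in right-associated words, at the end of the word or before a
    tail [z]. With the same rules for [y, x], this reduces the words that arise below. *)
Lemma band_words (A : algebra) (x y : A) : band A ->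
  [/\ x * x = x, forall z, x * (x * z) = x * z,
      x * (y * (x * y)) = x * y &
      forall z, x * (y * (x * (y * z))) = x * (y * z)].
Proof.
move=> [mA mI]; split=> [|z||z]; first exact: mI.
- by rewrite mA mI.
- by rewrite mA mI.
- by rewrite (mA x y (x * _)) !mA -(mA (x * y)) mI.
Qed.

Lemma band_term_normal_form (s : binary_term) :
  exists2 t, List.In t [:: VarX; VarY; XY; YX; XYX; YXY] & band_equiv s t.
Proof.
elim: s => [||s1 [t1 t1in E1] s2 [t2 t2in E2]].
- by exists VarX => //; left.
- by exists VarY => //; right; left.
suff [t tin Et] : exists2 t, List.In t [:: VarX; VarY; XY; YX; XYX; YXY] &
    band_equiv (Mul t1 t2) t.
  by exists t => // A bA x y; rewrite -Et //= E1 // E2.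
case: t1in => [<-|[<-|[<-|[<-|[<-|[<-|[]]]]]]];
case: t2in => [<-|[<-|[<-|[<-|[<-|[<-|[]]]]]]];
  (* There are 36 products of normal forms; backtracking over the six candidates finds the one to
     which the product rewrites. *)
  solve
    [ (exists VarX + exists VarY + exists XY + exists YX + exists XYX +
       exists YXY);
      [ by rewrite /=; tauto
      | by move=> A bA x y /=;
        have [xx xxz xyxy xyxyz] := band_words x y bA;
        have [yy yyz yxyx yxyxz] := band_words y x bA;
        rewrite -?bA.1 ?(xx, xxz, xyxy, xyxyz, yy, yyz, yxyx, yxyxz) ] ].
Qed.

(** * Computing the derived varieties *)

Lemma derived_algebra_eq (s : hypersubstitution) (A : algebra) :
  @term_op A s =2 @op A -> derived_algebra s A = A.
Proof.
case: A => T m n /= sm; rewrite /derived_algebra /=.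
by congr Algebra; apply: funext => x; apply: funext => y; exact: sm.
Qed.

Lemma derived_variety_eq (V W : set algebra) (s : hypersubstitution) :
  variety W -> (forall A, V A -> W (derived_algebra s A)) ->
  (forall A, W A -> exists2 B, V B & derived_algebra s B = A) ->
  derived_variety V s = W.
Proof.
move=> vW VW WV; apply/seteqP; split=> A.
- by apply; split=> // _ [B VB <-]; exact: VW.
- by move=> /WV [B VB <-] U [_]; apply; exists B.
Qed.

Lemma derived_variety_equiv (V : set algebra) (s t : hypersubstitution) :
  V `<=` band -> band_equiv s t -> derived_variety V s = derived_variety V t.
Proof.
move=> Vband st; rewrite /derived_variety; congr generated_variety.
apply: eq_imagel => A /Vband bA; rewrite /derived_algebra.
by congr Algebra; apply: funext => x; apply: funext => y; exact: st.
Qed.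

(** The outer factors in the defining identity need not be equal: squaring [xuvy] creates equal
    outer factors around each occurrence of [uv], and the two occurrences are swapped in turn. *)
Lemma normal_bandC (A : algebra) : normal_bands A ->
  forall x u v y : A, x * u * v * y = x * v * u * y.
Proof.
move=> [[mA mI] nA].
(* Write the right side as [abcabc]; the two sides then differ only by [cbac] against [cabc]. *)
have absorb a b c : a * b * c * (b * a * c) = a * b * c :> A.
  rewrite -[RHS]mI -!mA; congr (_ * (_ * _)).
  by have := nA b a c; rewrite -!mA.
have swap (x u v y : A) : x * (u * v * y) * x = x * (v * u * y) * x.
  by rewrite -(absorb u v y) mA nA -(mA x) absorb.
have swap' (x u v y : A) : y * x * (u * v) * y = y * x * (v * u) * y.
  by rewrite !(nA x) -!(mA y (_ * _) x) swap.
move=> x u v y; rewrite -[LHS]mI -[RHS]mI.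
transitivity (x * (u * v * y) * x * (u * v * y)); first by rewrite !mA.
rewrite swap.
transitivity (x * (v * u) * (y * x * (u * v) * y)); first by rewrite !mA.
by rewrite swap' !mA.
Qed.

Lemma left_normal_sub : left_normal_bands `<=` normal_bands.
Proof. by move=> A [bA lA]; split=> // x y z; rewrite (lA z x y). Qed.

Lemma right_normal_sub : right_normal_bands `<=` normal_bands.
Proof.
by move=> A [[mA mI] rA]; split=> // x y z; rewrite -!mA !(mA x) !(mA y) rA.
Qed.

Lemma derived_X : derived_variety normal_bands VarX = left_zero_bands.
Proof.
apply: (derived_variety_eq variety_left_zero_bands) => // A lA.
exists A; last by apply: derived_algebra_eq => x y /=; rewrite lA.
by split; [split=> [x y z|x]|move=> x y z]; rewrite !lA.
Qed.

Lemma derived_Y : derived_variety normal_bands VarY = right_zero_bands.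
Proof.
apply: (derived_variety_eq variety_right_zero_bands) => // A rA.
exists A; last by apply: derived_algebra_eq => x y /=; rewrite rA.
by split; [split=> [x y z|x]|move=> x y z]; rewrite !rA.
Qed.

Lemma derived_XY : derived_variety normal_bands XY = normal_bands.
Proof.
have XYE A : derived_algebra XY A = A by exact: derived_algebra_eq.
apply: (derived_variety_eq variety_normal_bands) => A NA; last by exists A.
by rewrite XYE.
Qed.

(** [YX] reverses the multiplication. Normality is self-dual, and reversing twice gives back the
    same algebra, so every normal band is derived from its opposite. *)
Lemma derived_YX : derived_variety normal_bands YX = normal_bands.
Proof.
have YXN A : normal_bands A -> normal_bands (derived_algebra YX A).
  move=> [[mA mI] nA]; split; [split=> [x y z|x]|move=> x y z] => /=.
  - by rewrite /= mA.
  - exact: mI.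
  - by have := nA y x z; rewrite -!mA.
apply: (derived_variety_eq variety_normal_bands) => // A NA.
exists (derived_algebra YX A); first exact: YXN.
by case: A NA.
Qed.

(** Both bracketings of three elements under the operation [xyx] equal [xyzx], which gives its
    associativity; read backwards, the same equations serve [yxy]. *)
Lemma normal_band_XYX (A : algebra) : normal_bands A -> forall x y z : A,
  x * y * x * z * (x * y * x) = x * y * z * x /\
  x * (y * z * y) * x = x * y * z * x.
Proof.
move=> NA x y z; have C := normal_bandC NA; case: NA => [[mA mI] nA].
split; last by rewrite !mA C -(mA x) mI.
transitivity (x * (y * z) * (x * y) * x); first by rewrite (C x y x z) mI !mA.
by rewrite nA !mA mI -(mA x) mI.
Qed.

Lemma derived_XYX : derived_variety normal_bands XYX = left_normal_bands.
Proof.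
apply: (derived_variety_eq variety_left_normal_bands) => A.
- move=> NA; have E := normal_band_XYX NA; case: (NA) => [[mA mI] nA].
  split; [split=> [x y z|x]|move=> x y z] => /=.
  - by rewrite (E x y z).1 (E x y z).2.
  - by rewrite !mI.
  - by rewrite (E x y z).1 (E x z y).1 normal_bandC.
(* In a left normal band [xyx = xxy = xy], so the derived operation is the original one. *)
- move=> lA; exists A; first exact: left_normal_sub.
  case: lA => [[mA mI] lA].
  by apply: derived_algebra_eq => x y /=; rewrite lA mI.
Qed.

Lemma derived_YXY : derived_variety normal_bands YXY = right_normal_bands.
Proof.
apply: (derived_variety_eq variety_right_normal_bands) => A.
- move=> NA; have E := normal_band_XYX NA; case: (NA) => [[mA mI] nA].
  split; [split=> [x y z|x]|move=> x y z] => /=.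
  - by rewrite (E z y x).1 (E z y x).2.
  - by rewrite !mI.
  - by rewrite (E z y x).2 (E z x y).2 normal_bandC.
- move=> rA; exists A; first exact: right_normal_sub.
  case: rA => [[mA mI] rA].
  by apply: derived_algebra_eq => x y /=; rewrite rA -mA mI.
Qed.

(** * Telling the varieties apart *)

Definition left_zero2 : algebra :=
  @Algebra bool (fun x _ => x) (inhabits true).
Definition right_zero2 : algebra :=
  @Algebra bool (fun _ y => y) (inhabits true).
Definition semilattice2 : algebra := @Algebra bool andb (inhabits true).

(** An invariant with decidable values: inequality of two classes becomes a computation on booleans,
    with no pairwise search for separating algebras. *)
Definition signature (V : set algebra) : bool * bool * bool :=
  (`[< V left_zero2 >], `[< V right_zero2 >], `[< V semilattice2 >]).

Lemma signature_left_zero : signature left_zero_bands = (true, false, false).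
Proof.
by congr (_, _, _); [apply/asboolP|apply/asboolPn..] => // h;
  have := h true false; have := h false true.
Qed.

Lemma signature_right_zero : signature right_zero_bands = (false, true, false).
Proof.
by congr (_, _, _); [apply/asboolPn|apply/asboolP|apply/asboolPn] => // h;
  have := h true false; have := h false true.
Qed.

Lemma signature_left_normal : signature left_normal_bands = (true, false, true).
Proof.
congr (_, _, _); [apply/asboolP|apply/asboolPn|apply/asboolP].
- by [].
- by case=> _ /(_ true true false).
- by split=> [|[] [] []] //; split=> [[] [] []|[]].
Qed.

Lemma signature_right_normal : signature right_normal_bands = (false, true, true).
Proof.
congr (_, _, _); [apply/asboolPn|apply/asboolP|apply/asboolP].
- by case=> _ /(_ true false true).
- by [].
- by split=> [|[] [] []] //; split=> [[] [] []|[]].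
Qed.

Lemma signature_normal : signature normal_bands = (true, true, true).
Proof.
congr (_, _, _); apply/asboolP => //.
by split=> [|[] [] []] //; split=> [[] [] []|[]].
Qed.

(** Index 3 falls on the default value of [nth], so the enumeration is injective on [I_4] but
    constant from 3 on. *)
Definition derived_of_index (i : nat) : set algebra :=
  nth right_normal_bands
    [:: left_zero_bands; right_zero_bands; left_normal_bands] i.

Definition signatureE := (signature_left_zero, signature_right_zero,
  signature_left_normal, signature_right_normal, signature_normal).

Lemma proper_derived_normal_bands :
  proper_derived_subvarieties normal_bands = derived_of_index @` `I_4.
Proof.
apply/seteqP; split=> W /=.
- move=> [s [WE WN _]]; have [t tin st] := band_term_normal_form s.
  have {s st}WE : W = derived_variety normal_bands t.
    by rewrite WE; apply: derived_variety_equiv => // A [].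
  (* The words [XY] and [YX] contradict properness; the other four give the indices 0 to 3. *)
  case: tin WE => [|[|[|[|[|[|[]]]]]]] <- WE.
  + by exists 0; rewrite // WE derived_X.
  + by exists 1; rewrite // WE derived_Y.
  + by case: WN; rewrite WE derived_XY.
  + by case: WN; rewrite WE derived_YX.
  + by exists 2; rewrite // WE derived_XYX.
  + by exists 3; rewrite // WE derived_YXY.
- case=> -[|[|[|[|//]]]] _ <- /=.
  + exists VarX; rewrite derived_X; split=> //.
      by move/(congr1 signature); rewrite !signatureE.
    move=> A lA; split; [split=> [x y z|x]|move=> x y z]; by rewrite !lA.
  + exists VarY; rewrite derived_Y; split=> //.
      by move/(congr1 signature); rewrite !signatureE.
    move=> A rA; split; [split=> [x y z|x]|move=> x y z]; by rewrite !rA.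
  + exists XYX; rewrite derived_XYX; split=> //; last exact: left_normal_sub.
    by move/(congr1 signature); rewrite !signatureE.
  + exists YXY; rewrite derived_YXY; split=> //; last exact: right_normal_sub.
    by move/(congr1 signature); rewrite !signatureE.
Qed.

Theorem theorem4p7 : has_dimension normal_bands 4.
Proof.
rewrite /has_dimension proper_derived_normal_bands; apply: inj_card_eq.
move=> i j; rewrite !inE /=.
by case: i => [|[|[|[|//]]]] _; case: j => [|[|[|[|//]]]] _ //=
  /(congr1 signature); rewrite !signatureE.
Qed.
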